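(* Let $p$ be a prime, let $s,r,m\ge 1$ be integers, $q=p^r$, $L=GR(p^s,r)$, and let $0\le \nu\le m(q-1)$. Let $\alpha:L^{q^m}\to(\mathbb{F}_q)^{q^m}$ be coordinatewise reduction modulo $p$. Then $$\alpha(RM_L(\nu,m))=RM_{\mathbb{F}_q}(\nu,m),$$ where $RM_{\mathbb{F}_q}(\nu,m)$ is the usual generalized Reed-Muller code of order $\nu$ and length $q^m$ over $\mathbb{F}_q$.
   Context: $L=GR(p^s,r)$ is the Galois ring of characteristic $p^s$ with $p^{sr}$ elements; it is local with maximal ideal $pL$ and residue field $L/pL=\mathbb{F}_q$. Put $n=q^m-1$. Let $h(x)\in L[x]$ be a monic basic primitive polynomial of degree $m$ (i.e. its reduction mod $p$ is a primitive polynomial over $\mathbb{F}_q$) dividing $x^{n}-1$, with a root $\xi$ of multiplicative order $n$ in $\mathcal{R}=L[x]/(h(x))=GR(p^s,rm)$. Then $\{1,\xi,\dots,\xi^{m-1}\}$ is an $L$-basis of $\mathcal{R}$. For $0\le i\le n-1$ write uniquely $\xi^i=b_{1i}+b_{2i}\xi+\dots+b_{mi}\xi^{m-1}$ with $b_{ji}\in L$, and set $b_i=(b_{1i},\dots,b_{mi})\in L^m$, $b_\infty=(0,\dots,0)$. For $P\in L[x_1,\dots,x_m]$ let $ev(P)=(P(b_\infty),P(b_0),P(b_1),\dots,P(b_{n-1}))\in L^{q^m}$. The generalized Reed-Muller code of order $\nu$ over $L$ is $$RM_L(\nu,m)=\{ev(P)\mid P\in L[x_1,\dots,x_m],\ \deg_{x_i}P\le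 q-1\ (1\le i\le m),\ \deg P\le\nu\},$$ where $\deg$ is the total degree and $\deg 0=-\infty$. The usual code $RM_{\mathbb{F}_q}(\nu,m)$ is the set of all vectors $(P(\bar b_\infty),P(\bar b_0),\dots,P(\bar b_{n-1}))$ with $P\in\mathbb{F}_q[x_1,\dots,x_m]$, $\deg_{x_i}P\le q-1$ for all $i$ and $\deg P\le \nu$, where $\bar b_i\in\mathbb{F}_q^m$ is the reduction of $b_i$ mod $p$ (the points $\bar b_\infty,\bar b_0,\dots,\bar b_{n-1}$ are all the points of $\mathbb{F}_q^m$). *)

(* Defs.v *)
From HB Require Import structures.
From mathcomp Require Import all_boot all_order all_algebra all_field.
From mathcomp Require Import ring_quotient.
From mathcomp Require Import mpoly.

Set Implicit Arguments.
Unset Strict Implicit.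
Unset Printing Implicit Defensive.

Import GRing.Theory.
Local Open Scope ring_scope.

Definition principal_ideal (R : finComNzRingType) (a : R) : {set R} :=
  [set a * y | y : R].

(* [idealr_closed] requires 1 \notin I, so it only accepts proper ideals. *)
Definition maximal_ideal (R : finComNzRingType) (I : {set R}) : Prop :=
  idealr_closed I /\
  forall J : {set R}, idealr_closed J -> I \subset J -> J = I.

Definition local_with_maximal_ideal (R : finComNzRingType) (I : {set R}) :
    Prop :=
  maximal_ideal I /\ forall J : {set R}, maximal_ideal J -> J = I.

Definition has_characteristic (R : finComNzRingType) (k : nat) : Prop :=
  forall n : nat, (n%:R == 0 :> R) = (k %| n)%N.

(* L is GR(p^s, r): these properties determine L up to isomorphism. *)
Definition is_galois_ring (p s r : nat) (L : finComNzRingType) : Prop :=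
  [/\ has_characteristic L (p ^ s),
      #|L| = (p ^ (s * r))%N &
      local_with_maximal_ideal (principal_ideal (p%:R : L))].

(* red presents the field F as the quotient L / pL. *)
Definition is_reduction_mod (p : nat) (L : finComNzRingType)
    (F : finFieldType) (red : {rmorphism L -> F}) : Prop :=
  (forall y : F, exists x : L, red x = y) /\
  (forall x : L, red x = 0 <-> x \in principal_ideal (p%:R : L)).

Definition divides_poly (R : comNzRingType) (f g : {poly R}) : Prop :=
  exists k : {poly R}, g = k * f.

(* The monicity and degree conditions matter for the use of {poly %/ h}, which
   is R[x]/(h) only when h is monic of positive degree. *)
Definition basic_primitive_poly (L : finComNzRingType) (F : finFieldType)
    (red : {rmorphism L -> F}) (m : nat) (h : {poly L}) : Prop :=
  [/\ h \is monic, size h = m.+1 & primitive_poly (map_poly red h)].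

(* The evaluation points (b_infty, b_0, b_1, ...): position 0 holds
   b_infty = 0 and position i.+1 holds b_i. *)
Definition eval_point (R : comNzRingType) (m N : nat) (b : nat -> 'rV[R]_m)
    (k : 'I_N) : 'rV[R]_m :=
  if k : nat is i.+1 then b i else 0.

Definition ev (R : comNzRingType) (m N : nat) (pt : 'I_N -> 'rV[R]_m)
    (P : {mpoly R[m]}) : 'rV[R]_N :=
  \row_k P.@[pt k 0].

(* msize P is 1 + deg P, and 0 for P = 0. *)
Definition grm_code (R : comNzRingType) (q nu m N : nat)
    (pt : 'I_N -> 'rV[R]_m) (c : 'rV[R]_N) : Prop :=
  exists P : {mpoly R[m]},
    [/\ forall (i : 'I_m) (e : 'X_{1..m}), e \in msupp P -> (e i <= q.-1)%N,
        (msize P <= nu.+1)%N &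
        c = ev pt P].

(* Main.v *)
(** Only the surjectivity of [L -> F] matters: reducing the coefficients of a
    polynomial does not enlarge its set of monomials, and conversely any
    polynomial over [F] lifts coefficient by coefficient to one over [L] with
    no new monomials.  Evaluation commutes with reduction. *)

Require Import Defs.
From HB Require Import structures.
From mathcomp Require Import all_boot all_order all_algebra all_field.
From mathcomp Require Import ring_quotient.
From mathcomp Require Import mpoly.

Set Implicit Arguments.
Unset Strict Implicit.
Unset Printing Implicit Defensive.

Import GRing.Theory.
Local Open Scope ring_scope.

(** [msize] is a maximum over the support alone, so polynomials over two different rings can be
    compared by their monomials. *)
Lemma msize_subset_msupp (R S : nzRingType) (m : nat)
    (P : {mpoly R[m]}) (Q : {mpoly S[m]}) :
  {subset msupp P <= msupp Q} -> (msize P <= msize Q)%N.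
Proof.
move=> sPQ; rewrite [msize P]msizeE; apply/bigmax_leqP_seq => e eP _.
exact/msize_mdeg_lt/sPQ.
Qed.

Lemma msupp_map_mpoly_sub (R S : nzRingType) (f : {additive R -> S}) (m : nat)
    (P : {mpoly R[m]}) :
  {subset msupp (map_mpoly f P) <= msupp P}.
Proof.
move=> e; rewrite !mcoeff_msupp mcoeff_map_mpoly; apply: contra => /eqP ->.
by rewrite raddf0.
Qed.

(** The section [g] is a mere function: it need not be additive, nor send 0 to 0. The lift is
    therefore summed over [msupp P] only, so that no monomial [e] outside it can receive the
    coefficient [g 0]. *)
Lemma map_mpoly_surj (R S : nzRingType) (f : {rmorphism R -> S}) (m : nat)
    (g : S -> R) (P : {mpoly S[m]}) :
  cancel g f ->
  exists2 Q : {mpoly R[m]},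
    {subset msupp Q <= msupp P} & map_mpoly f Q = P.
Proof.
move=> gK; exists (\sum_(e <- msupp P) g P@_e *: 'X_[e]).
- move=> e; rewrite !mcoeff_msupp; apply: contraNN => eP.
  rewrite raddf_sum /= big_seq big1 // => e' e'P.
  rewrite mcoeffZ mcoeffX; case: eqVneq => [ee'|_]; last by rewrite mulr0.
  by rewrite mcoeff_msupp ee' eP in e'P.
- rewrite raddf_sum /= [RHS]mpolyE; apply: eq_bigr => e _.
  by rewrite map_mpolyZ map_mpolyX gK.
Qed.

(** The link between [v] and [w] is pointwise because an entry of [map_mx f] becomes the image of an
    entry only after rewriting with [mxE]. *)
Lemma meval_map_mpoly (R S : comNzRingType) (f : {rmorphism R -> S}) (m : nat)
    (v : 'I_m -> R) (w : 'I_m -> S) (P : {mpoly R[m]}) :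
  (forall i, w i = f (v i)) -> (map_mpoly f P).@[w] = f P.@[v].
Proof.
move=> wE; elim/mpolyind: P => [|a e P _ _ IH]; first by rewrite !rmorph0.
have -> : map_mpoly f (a *: 'X_[e] + P) = f a *: 'X_[e] + map_mpoly f P.
  by rewrite raddfD /= map_mpolyZ map_mpolyX.
rewrite !mevalD !mevalZ !mevalX rmorphD rmorphM rmorph_prod IH.
congr (_ * _ + _).
by apply: eq_bigr => i _; rewrite wE rmorphXn.
Qed.

Lemma map_ev (R S : comNzRingType) (f : {rmorphism R -> S}) (m N : nat)
    (pt : 'I_N -> 'rV[R]_m) (P : {mpoly R[m]}) :
  map_mx f (ev pt P) = ev (fun k => map_mx f (pt k)) (map_mpoly f P).
Proof.
apply/rowP => k; rewrite !mxE; apply/esym/meval_map_mpoly => i.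
by rewrite mxE.
Qed.

Lemma grm_code_map_surj (R S : comNzRingType) (f : {rmorphism R -> S})
    (g : S -> R) (q nu m N : nat) (pt : 'I_N -> 'rV[R]_m) (c : 'rV[S]_N) :
  cancel g f ->
  (exists2 u, grm_code q nu pt u & map_mx f u = c)
  <-> grm_code q nu (fun k => map_mx f (pt k)) c.
Proof.
move=> gK; split=> [[_ [P [degP szP ->]] <-] | [P [degP szP ->]]].
- exists (map_mpoly f P); split; last exact: map_ev.
  + by move=> i e /msupp_map_mpoly_sub; apply: degP.
  + exact: leq_trans (msize_subset_msupp (@msupp_map_mpoly_sub _ _ f _ P)) szP.
(* Only the goal is rewritten: [degP] and [szP] still bound [P], and [sQP] carries both bounds over
   to [Q]. *)
- have [Q sQP <-] := map_mpoly_surj P gK; exists (ev pt Q); last exact: map_ev.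
  exists Q; split=> //; last exact: leq_trans (msize_subset_msupp sQP) szP.
  by move=> i e /sQP; apply: degP.
Qed.

Theorem proposition4p1 (p s r m nu : nat)
    (p_prime : prime p) (s_ge1 : (1 <= s)%N) (r_ge1 : (1 <= r)%N)
    (m_ge1 : (1 <= m)%N)
    (q : nat) (q_def : q = (p ^ r)%N)
    (n : nat) (n_def : n = (q ^ m - 1)%N)
    (nu_le : (nu <= m * (q - 1))%N)
    (L : finComNzRingType) (L_galois : is_galois_ring p s r L)
    (F : finFieldType) (red : {rmorphism L -> F})
    (red_mod : is_reduction_mod p red)
    (h : {poly L}) (h_prim : basic_primitive_poly red m h)
    (h_dvd : divides_poly h ('X^n - 1))
    (xi : {poly %/ h})
    (xi_root : root (map_poly (qpolyC h) h) xi)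
    (xi_order : n.-primitive_root xi)
    (b : nat -> 'rV[L]_m)
    (b_coord : forall i : nat, (i < n)%N ->
       xi ^+ i = \sum_(j < m) b i 0 j *: xi ^+ j) :
  forall c : 'rV[F]_(q ^ m),
    (exists2 u : 'rV[L]_(q ^ m),
       grm_code q nu (eval_point b) u & map_mx red u = c)
    <-> grm_code q nu (fun k => map_mx red (eval_point b k)) c.
Proof.
move=> c; case: red_mod => red_surj _.
(* With a boolean predicate, [xchoose] turns surjectivity into an actual section of [red], without a
   choice axiom. *)
have red_surjb y : exists x, red x == y.
  by have [x <-] := red_surj y; exists x.
apply: (@grm_code_map_surj _ _ red (fun y => xchoose (red_surjb y))) => y.
exact/eqP/(xchooseP (red_surjb y)).
Qed.
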